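(* For any complex numbers $z_1,\dots,z_n$ of modulus $1$, there exists a complex number $z$ of modulus $1$ such that $$\sum_{j=1}^n \frac{1}{|z-z_j|^2}\leq \frac{n^2}{4}.$$
   Context: A term with $z=z_j$ is understood to be $+\infty$, so the inequality in particular requires $z\neq z_j$ for all $j$. *)

(* Defs.v *)
From mathcomp Require Export all_boot all_order all_algebra.
From mathcomp Require Export complex.
From mathcomp Require Export reals constructive_ereal.

Set Implicit Arguments.
Unset Strict Implicit.
Unset Printing Implicit Defensive.

Import Order.TTheory GRing.Theory Num.Theory.
Local Open Scope ring_scope.

(* The inverse is taken in [\bar R], where [0^-1 = +oo], so that the term is
   [+oo] when [z = w]; the inverse of the field [R] would give [0] there.
   [normc] is the modulus as an element of [R]; the generic norm on [R[i]]
   takes its values in [R[i]]. *)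
Definition inv_sqr_dist (R : realType) (z w : R[i]) : \bar R :=
  (((Normc.normc (z - w)) ^+ 2)%:E^-1)%E.

(* Main.v *)
Require Import Defs.
From mathcomp Require Import separable cyclic cyclotomic.
From mathcomp Require Import ring.
From mathcomp Require Import topology normedtype.
From mathcomp Require Import realfun trigo derive.

Set Implicit Arguments.
Unset Strict Implicit.
Unset Printing Implicit Defensive.

Import Order.TTheory GRing.Theory Num.Theory numFieldNormedType.Exports.
Local Open Scope ring_scope.

(** Let [p(z) = prod_j (z - z_j)] and let [u] be a point of the unit circle where
[|p|] is largest. Then [u] is the required point.

After rotating so that [u = 1] and normalising, put [q = p / p(1)], so that
[q(1) = 1] and [|q| <= 1] on the circle, and write [S] for the sum of the
[1 / (1 - z_j)]. Logarithmic differentiation gives [q'(1) = S] and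
[q''(1) = S^2 - sum_j 1 / (1 - z_j)^2]. Since [1 / (1 - z)] has real part [1/2]
for [z] on the circle, [Re S = n/2], and the first order condition at the
maximum ([deriv_real_at_max]) makes [S] real, hence [S = n/2]. The same fact
about real parts gives [1 / (1 - z)^2 = 1 / (1 - z) - 1 / |1 - z|^2], and
everything combines into
  [(n - 1) q'(1) - q''(1) = n^2/4 - sum_j 1 / |1 - z_j|^2].

It remains to see that the left-hand side is nonnegative. This is Bernstein's
inequality for the second derivative, at a point where the polynomial reaches
its maximum modulus. Riesz's method proves it by an exact quadrature formula
with positive weights ([riesz_interpolation]): for [deg q <= n], the left-hand
side is the sum, over the [n]-th roots of unity [x <> 1], of
[(2 q(1) - q(x) - q(x^* )) / |1 - x|^2], and every term has a nonnegative real
part because [|q| <= 1 = q(1)]. On monomials the formula says that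
[m (n - m)] is the sum of the [|1 - x^m|^2 / |1 - x|^2], which is Parseval's
identity for the geometric sum [1 + x + ... + x^(m-1)]. *)

(** * Complex numbers of modulus one and roots of unity *)

Lemma prim_root_exists (C : numClosedFieldType) n :
  (0 < n)%N -> exists w : C, n.-primitive_root w.
Proof.
move=> n_gt0; have [r] := closed_field_poly_normal ('X^n - 1 : {poly C}).
rewrite (monicP (monicXnsubC _ n_gt0)) scale1r => Dp.
have r_roots : all n.-unity_root r.
  by apply/allP=> z; rewrite -root_prod_XsubC -Dp.
have r_uniq : uniq r.
  by rewrite -separable_prod_XsubC -Dp separable_Xn_sub_1 // pnatr_eq0 -lt0n.
have r_size : (n <= size r)%N.
  by rewrite -ltnS -(size_prod_XsubC r id) -Dp size_XnsubC.
by have /hasP[z _ zP] := has_prim_root n_gt0 r_roots r_uniq r_size; exists z.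
Qed.

Lemma norm_prim_rootX (C : numClosedFieldType) n (w : C) k :
  n.-primitive_root w -> `|w ^+ k| = 1.
Proof.
move=> pw; apply/eqP; rewrite -(@pexpr_eq1 _ _ n) ?(prim_order_gt0 pw) //.
by rewrite -normrX exprAC (prim_expr_order pw) expr1n normr1.
Qed.

Lemma conjC_unit (C : numClosedFieldType) (w : C) : `|w| = 1 -> w^* = w^-1.
Proof. by move=> w1; rewrite invC_norm w1 expr1n invr1 mul1r. Qed.

Lemma unit_neq0 (C : numClosedFieldType) (w : C) : `|w| = 1 -> w != 0.
Proof. by move=> w1; rewrite -normr_eq0 w1 oner_eq0. Qed.

(** Pigeonhole: the [n.+1] powers of a primitive root cannot all lie among [n]
points. *)
Lemma exists_unit_avoiding (C : numClosedFieldType) n (w : 'I_n -> C) :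
  exists2 z : C, `|z| = 1 & forall j, z != w j.
Proof.
have [om prim_om] := prim_root_exists C (ltn0Sn n).
pose s := [seq om ^+ (k : 'I_n.+1) | k : 'I_n.+1].
have s_uniq : uniq s.
  rewrite map_inj_uniq ?enum_uniq // => i j /eqP.
  by rewrite (eq_prim_root_expr prim_om) !modn_small // => /eqP/val_inj.
have /allPn[z /mapP[k _ zE] z_avoids] : ~~ all [in codom w] s.
  apply/negP => /allP /(uniq_leq_size s_uniq).
  by rewrite size_codom size_map -cardE !card_ord ltnn.
exists z; first by rewrite zE (norm_prim_rootX _ prim_om).
by move=> j; apply: contraNneq z_avoids => ->; apply: codom_f.
Qed.

(** * The quadrature formula *)

Lemma sum_unity_root (F : fieldType) n (x : F) :
  x ^+ n = 1 -> x != 1 -> \sum_(k < n) x ^+ k = 0.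
Proof.
move=> xn1 x1; apply: (mulfI (_ : x - 1 != 0)); first by rewrite subr_eq0.
by rewrite -subrX1 xn1 subrr mulr0.
Qed.

(** Expanding the squares, the orthogonality of the characters of [Z/n] leaves
only the diagonal terms, since the exponents below [m <= n] are distinct
modulo [n]. *)
Lemma parseval_geometric (C : numClosedFieldType) n (w : C) m :
  n.-primitive_root w -> (m <= n)%N ->
  \sum_(k < n) `|\sum_(a < m) (w ^+ k) ^+ a| ^+ 2 = (n * m)%:R.
Proof.
move=> pw le_mn.
have w0 : w != 0 by rewrite unit_neq0 // -(expr1 w) (norm_prim_rootX _ pw).
have expand k : `|\sum_(a < m) (w ^+ k) ^+ a| ^+ 2 =
    \sum_(a < m) \sum_(b < m) (w ^+ a / w ^+ b) ^+ k.
  rewrite normCK rmorph_sum big_distrlr /=.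
  apply: eq_bigr => a _; apply: eq_bigr => b _.
  rewrite rmorphXn /= (conjC_unit (norm_prim_rootX _ pw)).
  by rewrite exprMn exprVn exprVn -!exprM mulnC (mulnC b).
rewrite (eq_bigr _ (fun (k : 'I_n) _ => expand k)) exchange_big /=.
under eq_bigr do rewrite exchange_big /=.
have orth (a b : 'I_m) :
    \sum_(k < n) (w ^+ a / w ^+ b) ^+ k = if b == a then n%:R else 0.
  case: eqP => [->|/eqP neq_ba].
    rewrite divff ?expf_neq0 //.
    under eq_bigr do rewrite expr1n.
    by rewrite sumr_const card_ord.
  apply: sum_unity_root.
    by rewrite expr_div_n !(exprAC w _ n) (prim_expr_order pw) !expr1n divr1.
  apply: contra neq_ba => /eqP/divr1_eq/eqP.
  rewrite (eq_prim_root_expr pw).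
  by rewrite !modn_small ?(leq_trans (ltn_ord _)) // eq_sym.
under eq_bigr => a _.
  under eq_bigr do rewrite orth.
  rewrite -big_mkcond big_pred1_eq.
  over.
by rewrite sumr_const card_ord natrM mulr_natr.
Qed.

(** For [|x| = 1] the numerator [2 - x^m - (x^* )^m] is [|1 - x^m|^2], so each
quotient is the squared modulus of a geometric sum. The total follows from
Parseval by removing the term [m^2] of the root [1]. *)
Lemma riesz_monomial (C : numClosedFieldType) n (w : C) m :
  n.+1.-primitive_root w -> (m <= n.+1)%N ->
  \sum_(k < n) `|1 - w ^+ k.+1| ^- 2 *
     (2 - (w ^+ k.+1) ^+ m - ((w ^+ k.+1)^*) ^+ m) =
  m%:R * (n.+1%:R - m%:R).
Proof.
move=> pw le_mn; have := parseval_geometric pw le_mn.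
rewrite big_ord_recl /= expr0.
under [X in `|X|]eq_bigr do rewrite expr1n.
rewrite sumr_const card_ord normr_nat natrM => /(canRL (addKr _)) E.
transitivity (\sum_(k < n) `|\sum_(a < m) (w ^+ bump 0 k) ^+ a| ^+ 2); last first.
  by rewrite E; ring.
apply: eq_bigr => k _; rewrite /bump /= add1n.
have x1 := norm_prim_rootX k.+1 pw.
have x_neq1 : 1 - w ^+ k.+1 != 0.
  rewrite subr_eq0 eq_sym -(expr0 w) (eq_prim_root_expr pw) mod0n modn_small //.
  by rewrite ltnS.
move: (w ^+ k.+1) x1 x_neq1 => x x1 x_neq1.
apply: (mulfI (_ : `|1 - x| ^+ 2 != 0)); first by rewrite expf_neq0 ?normr_eq0.
rewrite mulrA divff ?expf_neq0 ?normr_eq0 // mul1r -exprMn -normrM.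
rewrite -normrN -mulNr opprB -subrX1 normCK rmorphB rmorph1 rmorphXn /=.
rewrite (conjC_unit x1).
have : x ^+ m * x^-1 ^+ m = 1 by rewrite -exprMn divff ?expr1n // unit_neq0.
by move=> xx; rewrite mulrBl mul1r mulrBr mulr1 xx; ring.
Qed.

(** Both sides are linear in [p], and on the monomial of degree [m] the right-hand
side is [n m - m (m - 1) = m (n.+1 - m)]. What matters is that the weights are
positive: a bound for [|p|] on the circle turns into a bound for the
derivatives of [p] at [1]. *)
Lemma riesz_interpolation (C : numClosedFieldType) n (w : C) (p : {poly C}) :
  n.+1.-primitive_root w -> (size p <= n.+2)%N ->
  \sum_(k < n) `|1 - w ^+ k.+1| ^- 2 *
     (2 * p.[1] - p.[w ^+ k.+1] - p.[(w ^+ k.+1)^*]) =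
  n%:R * p^`().[1] - p^`()^`().[1].
Proof.
move=> pw sz_p.
have pE x : p.[x] = \sum_(m < n.+2) p`_m * x ^+ m by apply: horner_coef_wide.
transitivity (\sum_(m < n.+2) p`_m * (m%:R * (n.+1%:R - m%:R))).
  transitivity (\sum_(k < n) \sum_(m < n.+2) p`_m * (`|1 - w ^+ k.+1| ^- 2 *
     (2 - (w ^+ k.+1) ^+ m - ((w ^+ k.+1)^*) ^+ m))).
    apply: eq_bigr => k _; rewrite !pE mulr_sumr -!sumrB mulr_sumr.
    by apply: eq_bigr => m _; rewrite expr1n; ring.
  rewrite exchange_big /=; apply: eq_bigr => m _.
  by rewrite -mulr_sumr riesz_monomial // -ltnS.
have -> : p = \sum_(m < n.+2) p`_m *: 'X^m.
  rewrite -poly_def; apply/polyP => i; rewrite coef_poly.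
  by case: ltnP => // le_i; rewrite nth_default // (leq_trans sz_p).
have dE : (\sum_(m < n.+2) p`_m *: 'X^m)^`().[1] = \sum_(m < n.+2) p`_m * m%:R.
  rewrite raddf_sum /= horner_sum; apply: eq_bigr => m _.
  by rewrite derivZ derivXn hornerZ hornerMn hornerXn expr1n.
have ddE : (\sum_(m < n.+2) p`_m *: 'X^m)^`()^`().[1] =
    \sum_(m < n.+2) p`_m * (m%:R * (m%:R - 1)).
  rewrite !raddf_sum /= horner_sum; apply: eq_bigr => m _.
  rewrite !derivZ derivXn derivMn derivXn hornerZ !hornerMn hornerXn expr1n.
  case: (nat_of_ord m) => [|i]; rewrite ?mul0r ?mulr0 //=.
  by rewrite -natr1 addrK -mulr_natl -mulr_natr; ring.
rewrite dE ddE mulr_sumr -sumrB; apply: eq_bigr => m _.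
rewrite -poly_def coef_poly ltn_ord.
by rewrite -natr1; ring.
Qed.

(** * Logarithmic derivatives of a product of linear factors *)

Lemma deriv_prod_XsubC (F : fieldType) (I : Type) (r : seq I) (z : I -> F) x :
  (forall i, x != z i) ->
  (\prod_(i <- r) ('X - (z i)%:P))^`().[x] =
  (\prod_(i <- r) ('X - (z i)%:P)).[x] * \sum_(i <- r) (x - z i)^-1.
Proof.
move=> x_neq; elim: r => [|i r IHr].
  by rewrite !big_nil derivC horner0 mulr0.
have xi : x - z i != 0 by rewrite subr_eq0.
rewrite !big_cons derivM derivXsubC mul1r !hornerE IHr.
have step (c P T : F) : c != 0 -> P + c * (P * T) = c * P * (c^-1 + T).
  by move=> c0; field.
exact: step.
Qed.

Lemma deriv2_prod_XsubC (F : fieldType) (I : Type) (r : seq I) (z : I -> F) x :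
  (forall i, x != z i) ->
  (\prod_(i <- r) ('X - (z i)%:P))^`()^`().[x] =
  (\prod_(i <- r) ('X - (z i)%:P)).[x] *
    ((\sum_(i <- r) (x - z i)^-1) ^+ 2 - \sum_(i <- r) (x - z i)^-1 ^+ 2).
Proof.
move=> x_neq; elim: r => [|i r IHr].
  by rewrite !big_nil derivC derivC horner0 expr0n subrr mulr0.
have xi : x - z i != 0 by rewrite subr_eq0.
rewrite !big_cons derivM derivXsubC mul1r derivD derivM derivXsubC mul1r !hornerE.
rewrite IHr deriv_prod_XsubC //.
have step (c P T T2 : F) : c != 0 -> P * T + P * T + c * (P * (T ^+ 2 - T2)) =
    c * P * ((c^-1 + T) ^+ 2 - (c^-1 ^+ 2 + T2)).
  by move=> c0; field.
exact: step.
Qed.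

(** * Reciprocals of distances to the point 1 *)

(** The map [w |-> 1 / (1 - w)] sends the unit circle to the line of the complex
numbers with real part [1/2]. *)
Lemma unit_inv_subr1D (C : numClosedFieldType) (w : C) : `|w| = 1 -> w != 1 ->
  (1 - w)^-1 + ((1 - w)^-1)^* = 1.
Proof.
move=> w1 w_neq1; have w0 := unit_neq0 w1.
rewrite fmorphV rmorphB rmorph1 /= conjC_unit //.
field.
by rewrite w0 subr_eq0 w_neq1 subr_eq0 eq_sym w_neq1.
Qed.

(** If [v + v^* = 1] then [v^2 = v - v v^*]. *)
Lemma unit_inv_subr1_sqr (C : numClosedFieldType) (w : C) :
  `|w| = 1 -> w != 1 -> (1 - w)^-1 ^+ 2 = (1 - w)^-1 - `|1 - w| ^- 2.
Proof.
move=> w1 w_neq1; rewrite -exprVn -normfV normCK.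
have /(canRL (addKr _)) -> := unit_inv_subr1D w1 w_neq1.
by ring.
Qed.

(** * The first order condition at a maximum *)

Lemma norm_horner_le (C : numClosedFieldType) (r : {poly C}) z :
  `|z| = 1 -> `|r.[z]| <= \sum_(i < size r) `|r`_i|.
Proof.
move=> z1; rewrite horner_coef; apply: le_trans (ler_norm_sum _ _ _) _.
by apply: ler_sum => i _; rewrite normrM normrX z1 expr1n mulr1.
Qed.

Lemma taylor2_at1 (F : fieldType) (q : {poly F}) :
  exists r : {poly F}, forall z,
    q.[z] = q.[1] + (z - 1) * q^`().[1] + (z - 1) ^+ 2 * r.[z].
Proof.
have [g gE] : exists g, q - q.[1]%:P = g * ('X - 1%:P).
  by apply/factor_theorem; rewrite rootE !hornerE subrr.
have [r rE] : exists r, g - g.[1]%:P = r * ('X - 1%:P).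
  by apply/factor_theorem; rewrite rootE !hornerE subrr.
have qE : q = g * ('X - 1%:P) + q.[1]%:P by rewrite -gE subrK.
have -> : q^`().[1] = g.[1].
  by rewrite qE derivD derivM derivXsubC derivC !hornerE subrr mulr0 add0r.
exists r => z; rewrite {1}qE -[g in LHS](subrK g.[1]%:P) rE !hornerE.
by ring.
Qed.

(** The tangential derivative of [Re q] along the circle at [1] is [- Im q'(1)],
and it vanishes because [Re q <= |q| <= 1 = q(1)]. Algebraically, the circle is
parametrised by the Cayley transform [z = (1 + i t) / (1 - i t)] for [t] real;
then [z - 1] is of order [t], and the expansion of [q] at [1] gives
[- t Im q'(1) <= K' t^2] for all real [t], with [K'] a constant. *)
Lemma deriv_real_at_max (C : numClosedFieldType) (q : {poly C}) :
  q.[1] = 1 -> (forall z, `|z| = 1 -> `|q.[z]| <= 1) -> q^`().[1] \is Num.real.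
Proof.
move=> q1 q_le1; have [r qE] := taylor2_at1 q; rewrite q1 in qE.
set S := q^`().[1] in qE *; set x := 'Re S; set y := 'Im S.
pose M := \sum_(i < size r) `|r`_i|.
have M_ge0 : 0 <= M by apply: sumr_ge0.
have xR : x \is Num.real by apply: Creal_Re.
have yR : y \is Num.real by apply: Creal_Im.
have cayley_bound t : t \is Num.real -> - (2 * t) * (y + t * x) <= 4 * t ^+ 2 * M.
  move=> tR.
  have N_gt0 : 0 < 1 + t ^+ 2 by rewrite ltr_wpDr // real_exprn_even_ge0.
  have N_neq0 : 1 + t ^+ 2 != 0 by rewrite gt_eqF.
  have NE : (1 - 'i * t) * (1 + 'i * t) = 1 + t ^+ 2.
    by rewrite -subr_sqr expr1n exprMn sqrCi mulN1r opprK.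
  have conj_t : (1 + 'i * t)^* = 1 - 'i * t.
    by rewrite rmorphD rmorphM rmorph1 /= conjCi (CrealP tR) mulNr.
  have z_neq0 : 1 - 'i * t != 0.
    by apply: contraNneq N_neq0 => e; rewrite -NE e mul0r.
  have z_neq0' : 1 + 'i * t != 0.
    by apply: contraNneq N_neq0 => e; rewrite -NE e mulr0.
  pose z := (1 + 'i * t) / (1 - 'i * t).
  have z1 : `|z| = 1.
    rewrite normrM normfV -conj_t norm_conjC divff //.
    by rewrite normr_eq0.
  have dE : z - 1 = 2 * t / (1 + t ^+ 2) * ('i - t).
    rewrite -NE.
    have -> : 'i - t = 'i * (1 + 'i * t).
      by rewrite mulrDr mulr1 mulrA -expr2 sqrCi mulN1r.
    by rewrite /z; field; rewrite z_neq0 z_neq0'.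
  have cR : 2 * t / (1 + t ^+ 2) \is Num.real.
    by rewrite rpredM ?rpredV ?rpredD ?rpredX ?rpred1 ?rpredM ?realn.
  have Re_dS : 'Re ((z - 1) * S) = 2 * t / (1 + t ^+ 2) * - (y + t * x).
    rewrite dE -(mulrA (2 * t / (1 + t ^+ 2))) (ReMl cR); congr (_ * _).
    by rewrite mulrBl raddfB /= ReMil (ReMl tR) opprD.
  have norm_d : `|z - 1| ^+ 2 = 4 * t ^+ 2 / (1 + t ^+ 2).
    rewrite dE normrM exprMn real_normK // normCK rmorphB /= conjCi (CrealP tR).
    have -> : ('i - t) * (- 'i - t) = 1 + t ^+ 2.
      by rewrite -opprD mulrN -subr_sqr sqrCi opprB opprK addrC.
    by field.
  have main : 'Re ((z - 1) * S) <= `|z - 1| ^+ 2 * M.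
    have -> : (z - 1) * S = q.[z] - 1 - (z - 1) ^+ 2 * r.[z] by rewrite qE; ring.
    rewrite !raddfB /= (Creal_ReP 1 _) ?rpred1 //.
    apply: (@le_trans _ _ (- 'Re ((z - 1) ^+ 2 * r.[z]))).
      rewrite lerBlDr addNr subr_le0.
      exact: le_trans (leif_Re_Creal _) (q_le1 _ z1).
    rewrite -raddfN /=; apply: le_trans (leif_Re_Creal _) _.
    by rewrite normrN normrM normrX ler_wpM2l ?exprn_ge0 // norm_horner_le.
  move: main; rewrite Re_dS norm_d.
  rewrite -(ler_pM2r N_gt0).
  congr (_ <= _); by field.
(* The bound reads [- t y <= t^2 (x + 2 M)]. At [t = - y / K] with
   [K > x + 2 M], it forces [t^2 <= 0]. The modulus of [x] makes [K] positive
   whatever the sign of [x]. *)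
pose K := `|x| + 2 * M + 1.
have K_gt0 : 0 < K by rewrite ltr_wpDl // addr_ge0 ?mulr_ge0 ?ler0n.
have sR : - (y / K) \is Num.real by rewrite rpredN rpredM // rpredV gtr0_real.
have := cayley_bound _ sR.
rewrite -subr_le0.
have -> : - (2 * - (y / K)) * (y + - (y / K) * x) - 4 * (- (y / K)) ^+ 2 * M =
   (2 * (`|x| - x + 1)) * (- (y / K)) ^+ 2.
  have -> : `|x| = K - 2 * M - 1 by rewrite /K; ring.
  by field; rewrite gt_eqF.
rewrite pmulr_rle0; last first.
  by rewrite mulr_gt0 ?ltr0n // ltr_wpDl // subr_ge0 real_ler_norm.
move=> s_le0; have : (- (y / K)) ^+ 2 == 0.
  by rewrite eq_le s_le0 real_exprn_even_ge0.
rewrite expf_eq0 oppr_eq0 mulf_eq0 invr_eq0 (gt_eqF K_gt0) orbF /= => /eqP y0.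
by apply/Creal_ImP.
Qed.

(** * The bound at a point of maximum modulus *)

(** The quadrature formula is applied to [q = p / p(1)], where [p] is the product
of the ['X - w j], with the roots of unity of order [n.+1], the degree of [q].
This turns the maximality of [|p|] at [1] into the bound. *)
Lemma sum_inv_sqr_le_at1 (C : numClosedFieldType) n (w : 'I_n.+1 -> C) :
  (forall j, `|w j| = 1) -> (forall j, w j != 1) ->
  (forall z, `|z| = 1 -> \prod_j `|z - w j| <= \prod_j `|1 - w j|) ->
  \sum_j `|1 - w j| ^- 2 <= n.+1%:R ^+ 2 / 4.
Proof.
move=> w1 w_neq1 w_max.
pose p := \prod_j ('X - (w j)%:P).
have pE z : p.[z] = \prod_j (z - w j).
  by rewrite horner_prod; apply: eq_bigr => j _; rewrite !hornerE.
have p1_neq0 : p.[1] != 0.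
  by rewrite pE; apply/prodf_neq0 => j _; rewrite subr_eq0 eq_sym.
pose q := p.[1]^-1 *: p.
have q1 : q.[1] = 1 by rewrite hornerZ mulVf.
have q_le1 z : `|z| = 1 -> `|q.[z]| <= 1.
  move=> z1; rewrite hornerZ mulrC normrM normfV ler_pdivrMr ?normr_gt0 // mul1r.
  by rewrite !pE !normr_prod w_max.
pose S := \sum_j (1 - w j)^-1.
have w_neq1' j : 1 != w j by rewrite eq_sym.
have dq : q^`().[1] = S.
  by rewrite derivZ hornerZ deriv_prod_XsubC // mulKf.
have ddq : q^`()^`().[1] = S ^+ 2 - S + \sum_j `|1 - w j| ^- 2.
  rewrite !derivZ hornerZ deriv2_prod_XsubC // mulKf //.
  under [X in _ - X]eq_bigr do rewrite unit_inv_subr1_sqr //.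
  by rewrite sumrB opprB addrA addrAC.
have SE : S = n.+1%:R / 2.
  have SR : S \is Num.real by rewrite -dq deriv_real_at_max.
  apply: (mulIf (_ : 2 != 0)); first by rewrite pnatr_eq0.
  rewrite divfK ?pnatr_eq0 // mulr_natr mulr2n -{2}(CrealP SR) rmorph_sum /=.
  rewrite -big_split /= (eq_bigr (fun=> 1)) => [|j _].
    by rewrite sumr_const card_ord.
  exact: unit_inv_subr1D.
have [om prim_om] := prim_root_exists C (ltn0Sn n).
have sz_q : (size q <= n.+2)%N.
  rewrite (leq_trans (size_scale_leq _ _)) //.
  by rewrite size_prod_XsubC /index_enum -enumT size_enum_ord.
have := riesz_interpolation prim_om sz_q.
rewrite dq ddq.
have -> : n%:R * S - (S ^+ 2 - S + \sum_j `|1 - w j| ^- 2) =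
    n.+1%:R ^+ 2 / 4 - \sum_j `|1 - w j| ^- 2.
  by rewrite SE -natr1; field.
move=> E; rewrite -subr_ge0.
(* The left-hand side is real, so comparing real parts is enough. *)
have /Creal_ReP <- : n.+1%:R ^+ 2 / 4 - \sum_j `|1 - w j| ^- 2 \is Num.real.
  rewrite rpredB ?rpredM ?rpredV ?rpredX ?realn //.
  by apply: rpred_sum => j _; rewrite rpredV rpredX // normr_real.
rewrite -E raddf_sum /= sumr_ge0 // => k _.
have omR : `|1 - om ^+ k.+1| ^- 2 \is Num.real.
  by rewrite rpredV rpredX ?normr_real.
rewrite ReMl // mulr_ge0 ?invr_ge0 ?exprn_ge0 //.
rewrite q1 mulr1 !raddfB /= (Creal_ReP 2 _) ?realn //.
have om1 := norm_prim_rootX k.+1 prim_om.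
rewrite -addrA -opprD subr_ge0 -[leRHS]/(1 + 1) lerD //.
  exact: le_trans (leif_Re_Creal _) (q_le1 _ om1).
by apply: le_trans (leif_Re_Creal _) (q_le1 _ _); rewrite norm_conjC.
Qed.

(** * Existence of the maximum on the circle *)

Lemma normCE (R : rcfType) (z : R[i]) : `|z| = (Normc.normc z)%:C%C.
Proof. by []. Qed.

Lemma normc_eq1 (R : rcfType) (z : R[i]) : (Normc.normc z = 1) <-> (`|z| = 1).
Proof. by rewrite normCE; split=> [->|[]]. Qed.

Lemma polar_unit (R : realType) (z : R[i]) : `|z| = 1 ->
  exists2 t : R, - pi <= t <= pi & z = (cos t +i* sin t)%C.
Proof.
case: z => x y /normc_eq1 /= xy1.
have {}xy1 : x ^+ 2 + y ^+ 2 = 1.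
  by rewrite -[LHS]sqr_sqrtr ?xy1 ?expr1n // addr_ge0 ?sqr_ge0.
have x_itv : -1 <= x <= 1.
  rewrite -ler_norml -(@ler_pXn2r _ 2) ?nnegrE ?ler01 // real_normK ?num_real //.
  by rewrite expr1n -xy1 lerDl sqr_ge0.
have [ge0 lepi] : 0 <= acos x /\ acos x <= pi by rewrite acos_ge0 ?acos_lepi.
have cosE : cos (acos x) = x by rewrite acosK ?in_itv.
have sinE : sin (acos x) = `|y|.
  by rewrite sin_acos // -xy1 addrC addKr sqrtr_sqr.
have pi0 := pi_ge0 R.
have [y0|y0] := leP 0 y.
  exists (acos x); first by rewrite lepi (le_trans _ ge0) // oppr_le0.
  by rewrite cosE sinE ger0_norm.
exists (- acos x).
  by rewrite lerN2 lepi (le_trans _ pi0) // oppr_le0.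
by rewrite cosN sinN cosE sinE ltr0_norm ?opprK.
Qed.

(** The circle is the image of the segment [[-pi, pi]] under [t |-> e^(i t)], so
the extreme value theorem for real functions on a segment applies. *)
Lemma exists_max_prod_dist (R : realType) n (w : 'I_n -> R[i]) :
  exists2 u : R[i], `|u| = 1 &
    forall z, `|z| = 1 -> \prod_j `|z - w j| <= \prod_j `|u - w j|.
Proof.
pose circ (t : R) : R[i] := (cos t +i* sin t)%C.
have circ1 t : `|circ t| = 1 by apply/normc_eq1; rewrite /= cos2Dsin2 sqrtr1.
pose f t := \prod_j Normc.normc (circ t - w j).
have fE t : \prod_j `|circ t - w j| = (f t)%:C%C by rewrite rmorph_prod.
have f_cont : continuous f.
  move=> t; apply: cvg_big => [|j _]; first exact: mul_continuous.
  rewrite /circ; case: (w j) => a b /=.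
  apply: continuous_comp; last exact: sqrt_continuous.
  apply: cvgD.
    by apply: cvgM; (apply: cvgB; [exact: continuous_cos | exact: cvg_cst]).
  by apply: cvgM; (apply: cvgB; [exact: continuous_sin | exact: cvg_cst]).
have pi_itv : - pi <= pi :> R by rewrite ge0_cp ?pi_ge0.
have [c _ c_max] := EVT_max pi_itv (continuous_subspaceT f_cont).
exists (circ c) => // z /polar_unit[t t_itv ->].
by rewrite !fE lecR c_max // in_itv.
Qed.

(** * The theorem *)

Theorem theorem1p12 (R : realType) (n : nat) (zs : 'I_n -> R[i])
    (hzs : forall j, Normc.normc (zs j) = 1) :
  exists z : R[i], Normc.normc z = 1 /\
    (\sum_(j < n) inv_sqr_dist z (zs j) <= (n%:R ^+ 2 / 4%:R)%R%:E)%E.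
Proof.
case: n zs hzs => [|n] zs hzs.
  exists 1; split; first exact: Normc.normc1.
  by rewrite big_ord0 lee_fin expr0n mul0r.
have [u u1 u_max] := exists_max_prod_dist zs.
have u_neq0 := unit_neq0 u1.
(* The maximum is positive, so it is not reached at any of the [zs j]. *)
have u_neq j : u != zs j.
  have [v v1 v_neq] := exists_unit_avoiding zs.
  have : 0 < \prod_j `|u - zs j|.
    apply: lt_le_trans (u_max v v1).
    by apply: prodr_gt0 => i _; rewrite normr_gt0 subr_eq0.
  apply: contraTneq => uE; rewrite (bigD1 j) //= uE subrr normr0 mul0r.
  by rewrite ltxx.
pose w j := zs j / u.
have rotate z j : `|z * u - zs j| = `|z - w j|.
  by rewrite -{1}[zs j](divfK u_neq0) -mulrBl normrM u1 mulr1.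
have rotate1 j : `|1 - w j| = `|u - zs j| by rewrite -rotate mul1r.
have bound : \sum_j `|u - zs j| ^- 2 <= n.+1%:R ^+ 2 / 4.
  under eq_bigr do rewrite -rotate1.
  apply: sum_inv_sqr_le_at1 => [j|j|z z1].
  - by rewrite normrM normfV u1 divr1; apply/normc_eq1.
  - by rewrite -subr_eq0 -normr_eq0 distrC rotate1 normr_eq0 subr_eq0.
  - under eq_bigr do rewrite -rotate.
    under [leRHS]eq_bigr do rewrite rotate1.
    by apply: u_max; rewrite normrM z1 u1 mulr1.
exists u; split; first exact/normc_eq1.
have termE j : inv_sqr_dist u (zs j) = ((Normc.normc (u - zs j) ^- 2)%:E)%E.
  rewrite /inv_sqr_dist inver expf_eq0 /=; case: eqP => // /Normc.eq0_normc/eqP.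
  by rewrite subr_eq0 (negPf (u_neq j)).
under eq_bigr do rewrite termE.
rewrite sumEFin lee_fin -lecR rmorph_sum /=.
under eq_bigr do rewrite fmorphV rmorphXn /= -normCE.
by rewrite rmorphM fmorphV rmorphXn !rmorph_nat.
Qed.
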